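(* Let $n$ be a positive integer, let $p\in(0,1)$, let $X\sim \mathrm{Bin}(n,p)$, and let $k$ be a positive integer such that $np<k\le n$. Then \[ \mathbb{E}\left[X \mid X\geq k\right] \leq k + \frac{(n-k)p}{k-np+p}. \] Furthermore, if $k$ satisfies $np<k\le n-1$, then, setting $\ell := \left\lfloor \frac{k-np}{1-p} \right\rfloor$, we have $\ell<k$ and \[ \mathbb{P}\left[X \geq k\right] \geq \frac{p^{2(\ell+1)}}{2}\cdot \binom{n}{\ell+1}\Big/\binom{k}{\ell+1}. \]
   Context: $\mathrm{Bin}(n,p)$ denotes a binomial random variable with parameters $n$ (number of trials) and $p$ (success probability), and $X\sim\mathrm{Bin}(n,p)$ means that $X$ has this distribution. $\mathbb{E}[X\mid X\ge k]=\sum_{i\ge k} i\,\mathbb{P}[X=i]/\mathbb{P}[X\ge k]$ is the tail conditional expectation. $\lfloor x\rfloor$ is the largest integer less than or equal to $x$. *)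

(* Defs.v *)
From HB Require Import structures.
From mathcomp Require Export all_boot all_order all_algebra.
From mathcomp Require Export all_classical all_reals all_analysis.
Export Order.TTheory GRing.Theory Num.Theory.
Export numFieldNormedType.Exports.

Set Implicit Arguments.
Unset Strict Implicit.
Unset Printing Implicit Defensive.

Local Open Scope classical_set_scope.
Local Open Scope ring_scope.

Definition is_binomial (d : measure_display) (T : measurableType d)
    (R : realType) (P : probability T R) (X : {RV P >-> nat})
    (n : nat) (p : R) : Prop :=
  forall A : set nat, distribution P X A = binomial_prob n p A.

(* The quotient is taken in the extended reals, where x / 0 = x * +oo; it is
   the usual conditional expectation as soon as P[X >= k] > 0. *)
Definition tail_cond_expectation (d : measure_display) (T : measurableType d)
    (R : realType) (P : probability T R) (X : {RV P >-> nat}) (k : nat) :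
    \bar R :=
  ((\sum_(k <= i <oo) (i%:R)%:E * P [set w | X w = i])
    / P [set w | (k <= X w)%N])%E.

(* Main.v *)
Require Import Defs.
From mathcomp Require Import ring lra zify.

(* Write b_i = P[X = i], S_k = P[X >= k] and q = 1 - p.

   Since (i - np) b_i = i q b_i - (i + 1) q b_(i+1), the sum of (i - np) b_i
   over i >= k telescopes to k q b_k.  With this identity the bound on E[X | X >= k]
   at k follows from the one at k + 1, by downward induction from k = n.

   For the lower bound put m = l + 1.  If the first m trials succeed, then
   X >= k as soon as the n - m others give at least k - m successes, and
   k - m < (n - m) p by the choice of l.  An integer below its mean is reached
   by Bin(n - m, p) with probability at least 1/2, so S_k >= p^m / 2.
   Finally p^m C(n, m) <= C(k, m), because (n - i) p <= k - i for all i <= l.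

   The fact on medians: for j <= Np, the differences
   d_i = b_(j+i) - b_(j-1-i) change sign at most once, from + to -, while
   \sum_i i d_i >= 0 because the mean is Np; hence \sum_i d_i >= 0. *)

Set Implicit Arguments.
Unset Strict Implicit.
Unset Printing Implicit Defensive.

Local Open Scope classical_set_scope.
Local Open Scope ring_scope.

(** * Sequences with a single sign change *)

Lemma sum_ge0_sign_change (R : realFieldType) (d : nat -> R) (M : nat) :
  0 <= d 0%N -> (forall i j, d i < 0 -> (i <= j)%N -> d j <= 0) ->
  0 <= \sum_(0 <= i < M) i%:R * d i -> 0 <= \sum_(0 <= i < M) d i.
Proof.
move=> d0 sgn mean.
have [[i di]|/forallNP noneg] := pselect (exists i, d i < 0); last first.
  by apply: sumr_ge0 => i _; rewrite leNgt; apply/negP.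
pose c := ex_minn (ex_intro _ i di : exists i, d i < 0).
have [dc cmin] : d c < 0 /\ forall j, d j < 0 -> (c <= j)%N.
  by rewrite /c; case: ex_minnP.
have c0 : (0 < c)%N.
  by rewrite lt0n; apply/eqP => cE; move: dc; rewrite cE ltNge d0.
(* [c] is where the sign changes, so [(c - j) d_j >= 0] for all [j]. *)
have le : 0 <= \sum_(0 <= j < M) (c%:R - j%:R) * d j.
  apply: sumr_ge0 => j _; have [cj|jc] := leqP c j.
    by rewrite mulr_le0 ?subr_le0 ?ler_nat// (sgn c).
  rewrite mulr_ge0 ?subr_ge0 ?ler_nat 1?ltnW//.
  by rewrite leNgt; apply/negP => /cmin; rewrite leqNgt jc.
have : 0 <= c%:R * \sum_(0 <= j < M) d j.
  rewrite mulr_sumr; move: (addr_ge0 mean le); rewrite -big_split/=.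
  by under eq_bigr do rewrite -mulrDl addrC subrK.
by rewrite pmulr_rge0 ?ltr0n.
Qed.

(** From i to s = i + 1 the quotient x / y gains the factor (A^2 - s^2) p^2 / ((J^2 - s^2) q^2). As
    q J <= p A, this is below 1 only if q < p, and then it stays below 1 while s < J; so once x is
    below y, it cannot come back above. *)
Lemma ratio_sign_change (R : realFieldType) (p q A J : R) (x y : nat -> R) :
  0 < p -> 0 < q -> 0 <= A -> 0 <= J -> q * J <= p * A ->
  (forall i, 0 <= x i) -> (forall i, 0 <= y i) -> y 0%N <= x 0%N ->
  (forall i, x i.+1 * (J + i.+1%:R) * q = (A - i.+1%:R) * p * x i) ->
  (forall i, y i * (J - i.+1%:R) * q = (A + i.+1%:R) * p * y i.+1) ->
  forall i j, x i < y i -> (i <= j)%N -> x j <= y j.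
Proof.
move=> p0 q0 A0 J0 qJpA x0 y0 yx0 xS yS.
(* For [s < J], [cond s] says that [x / y] decreases from [s - 1] to
   [s]; given [q < p], it persists when [s] grows. *)
pose cond s := (A ^+ 2 - s ^+ 2) * p ^+ 2 < (J ^+ 2 - s ^+ 2) * q ^+ 2 /\ q < p.
have condS (s : R) : 0 <= s -> cond s -> cond (s + 1).
  move=> s0 [cs qp]; split=> //.
  have : 0 <= (p ^+ 2 - q ^+ 2) * ((s + 1) ^+ 2 - s ^+ 2).
    by rewrite mulr_ge0 ?subr_ge0 ?ler_sqr ?nnegrE//; nra.
  nra.
have yJ i : J <= i.+1%:R -> y i.+1 = 0.
  move=> Ji; apply/eqP; rewrite eq_le y0 andbT.
  have := yS i; have i0 : 0 < i.+1%:R :> R by rewrite ltr0n.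
  have : y i * (J - i.+1%:R) * q <= 0.
    by rewrite -mulrA mulr_ge0_le0// mulr_le0_ge0 ?subr_le0// ltW.
  move=> h e; move: h; rewrite e pmulr_rle0// mulr_gt0//; lra.
(* Multiplying the recurrence of x by (J - s) q and that of y by (A - s) p gives both the factor
   [K], so they compare without division. *)
pose K i := (A - i.+1%:R) * (J - i.+1%:R) * (p * q).
have xK i : x i.+1 * ((J ^+ 2 - i.+1%:R ^+ 2) * q ^+ 2) = K i * x i.
  transitivity (x i.+1 * (J + i.+1%:R) * q * ((J - i.+1%:R) * q)).
    by ring.
  by rewrite xS /K; ring.
have yK i : y i.+1 * ((A ^+ 2 - i.+1%:R ^+ 2) * p ^+ 2) = K i * y i.
  transitivity ((A + i.+1%:R) * p * y i.+1 * ((A - i.+1%:R) * p)).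
    by ring.
  by rewrite -yS /K; ring.
have K0 i : 0 <= A - i.+1%:R -> 0 <= J - i.+1%:R -> 0 <= K i.
  by move=> ? ?; rewrite !mulr_ge0// ltW.
(* Where x passes below y the quotient has just dropped, whence [cond]; if x was already below y,
   [condS] carries it on. *)
have first i : x i < y i -> cond i%:R.
  elim: i => [|i IH] xyi; first by move: xyi; rewrite ltNge yx0.
  have iJ : i.+1%:R < J.
    by rewrite ltNge; apply/negP => /yJ yE; move: xyi; rewrite yE ltNge x0.
  have i0 : 0 < i.+1%:R :> R by rewrite ltr0n.
  have [/IH ci|yxi] := ltP (x i) (y i).
    by rewrite -addn1 natrD; apply: condS.
  have ca : (A ^+ 2 - i.+1%:R ^+ 2) * p ^+ 2
          < (J ^+ 2 - i.+1%:R ^+ 2) * q ^+ 2.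
    rewrite ltNge; apply/negP => cN; move: xyi; rewrite ltNge => /negP; apply.
    have JJ : 0 < (J ^+ 2 - i.+1%:R ^+ 2) * q ^+ 2.
      by rewrite mulr_gt0 ?exprn_gt0// subr_gt0 ltr_sqr ?nnegrE// ltW.
    have Ai : 0 <= A - i.+1%:R.
      have : 0 < (A ^+ 2 - i.+1%:R ^+ 2) * p ^+ 2 by lra.
      rewrite pmulr_lgt0 ?exprn_gt0// subr_gt0 ltr_sqr ?nnegrE//.
      by move=> ?; rewrite subr_ge0 ltW.
    rewrite -(ler_pM2r JJ) xK.
    apply: (@le_trans _ _ (K i * y i)); first by rewrite -yK ler_wpM2l.
    by rewrite ler_wpM2l// K0// subr_ge0 ltW.
  split=> //; rewrite ltNge; apply/negP => pq.
  have : (q * J) ^+ 2 <= (p * A) ^+ 2.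
    by rewrite ler_sqr ?nnegrE// mulr_ge0// ltW.
  have : 0 <= (q ^+ 2 - p ^+ 2) * i.+1%:R ^+ 2.
    by rewrite mulr_ge0 ?sqr_ge0// subr_ge0 ler_sqr ?nnegrE// ltW.
  by rewrite !exprMn; move: ca; lra.
have next i : x i <= y i -> cond i.+1%:R -> x i.+1 <= y i.+1.
  move=> xyi [ci qp].
  have i0 : 0 < i.+1%:R :> R by rewrite ltr0n.
  (* If A <= i + 1, the recurrence forces x_(i+1) <= 0. Otherwise the left side of [cond] is
     nonnegative, so i + 1 < J. *)
  have [Ai|iA] := leP A i.+1%:R.
    rewrite (le_trans _ (y0 _))//.
    rewrite -(@pmulr_lle0 _ ((J + i.+1%:R) * q)); last first.
      by rewrite mulr_gt0//; lra.
    by rewrite mulrA xS -mulrA mulr_le0_ge0 ?subr_le0// mulr_ge0// ltW.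
  have iJ : i.+1%:R < J.
    rewrite -(@ltr_pXn2r _ 2)// ?nnegrE ?ltW// -subr_gt0.
    rewrite -(@pmulr_lgt0 _ (q ^+ 2)) ?exprn_gt0//; apply: le_lt_trans ci.
    by rewrite mulr_ge0 ?sqr_ge0// subr_ge0 ler_sqr ?nnegrE// ltW.
  have JJ : 0 < (J ^+ 2 - i.+1%:R ^+ 2) * q ^+ 2.
    by rewrite mulr_gt0 ?exprn_gt0// subr_gt0 ltr_sqr ?nnegrE// ltW.
  rewrite -(ler_pM2r JJ) xK.
  apply: (@le_trans _ _ (K i * y i)).
    by rewrite ler_wpM2l// K0// subr_ge0 ltW.
  by rewrite -yK ler_wpM2l// ltW.
move=> i j xyi ij; suff [] : x j <= y j /\ cond j%:R by [].
elim: j ij => [|j IH].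
  by rewrite leqn0 => /eqP <-; split; [exact: ltW | exact: first].
rewrite leq_eqVlt => /orP[/eqP <-|/IH[xyj cj]].
  by split; [exact: ltW | exact: first].
have cSj : cond j.+1%:R by rewrite -addn1 natrD; apply: condS.
by split=> //; apply: next.
Qed.

(** * Binomial weights and their tails *)

Definition binomial_tail (R : realType) (n : nat) (p : R) (k : nat) : R :=
  \sum_(k <= i < n.+1) binomial_pmf n p i.

Lemma binomial_pmfE (R : realType) (n : nat) (p : R) (i : nat) :
  binomial_pmf n p i = p ^+ i * (1 - p) ^+ (n - i) *+ 'C(n, i).
Proof. by []. Qed.

Lemma binomial_pmf_small (R : realType) (n : nat) (p : R) (i : nat) :
  (n < i)%N -> binomial_pmf n p i = 0.
Proof. by move=> ni; rewrite !binomial_pmfE bin_small. Qed.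

Lemma binomial_pmf_gt0 (R : realType) (n : nat) (p : R) (i : nat) :
  0 < p < 1 -> (i <= n)%N -> 0 < binomial_pmf n p i.
Proof.
move=> /andP[p0 p1] ni.
by rewrite !binomial_pmfE pmulrn_lgt0 ?bin_gt0// mulr_gt0 ?exprn_gt0 ?subr_gt0.
Qed.

Lemma binomial_pmf_step (R : realType) (n : nat) (p : R) (i : nat) :
  binomial_pmf n p i.+1 * (i.+1%:R * (1 - p))
  = binomial_pmf n p i * ((n%:R - i%:R) * p).
Proof.
(* For i >= n both sides vanish: n - i is taken in [R], and is 0 at i = n. *)
have [ni|ni] := ltnP i n; last first.
  rewrite binomial_pmf_small ?ltnS// mul0r.
  move: ni; rewrite leq_eqVlt => /orP[/eqP ->|ni].
    by rewrite subrr mul0r mulr0.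
  by rewrite binomial_pmf_small// mul0r.
rewrite -natrB 1?ltnW// !binomial_pmfE subnS.
have : (0 < n - i)%N by rewrite subn_gt0.
case E : (n - i)%N => [//|m] _ /=.
have : (i.+1%:R * 'C(n, i.+1)%:R = m.+1%:R * 'C(n, i)%:R :> R).
  by rewrite -!natrM mul_bin_left E.
move=> h; rewrite -(mulr_natr _ 'C(n, i.+1)) -(mulr_natr _ 'C(n, i)) !exprS.
transitivity (p * p ^+ i * (1 - p) ^+ m * (1 - p)
              * (i.+1%:R * 'C(n, i.+1)%:R)); first by ring.
by rewrite h; ring.
Qed.

Lemma sum_centered_binomial_pmf (R : realType) (n : nat) (p : R) (k : nat) :
  (k <= n.+1)%N ->
  \sum_(k <= i < n.+1) (i%:R - n%:R * p) * binomial_pmf n p i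
  = k%:R * (1 - p) * binomial_pmf n p k.
Proof.
move=> kn; pose f i : R := - (i%:R * (1 - p) * binomial_pmf n p i).
rewrite (eq_bigr (fun i => f i.+1 - f i)) => [|i _].
  by rewrite telescope_sumr// /f binomial_pmf_small// mulr0 oppr0 add0r opprK.
have := binomial_pmf_step n p i.
rewrite /f opprK mulrC => h.
have -> : i.+1%:R * (1 - p) * binomial_pmf n p i.+1
        = binomial_pmf n p i * ((n%:R - i%:R) * p) by rewrite -h mulrC.
by ring.
Qed.

Lemma binomial_tail0 (R : realType) (n : nat) (p : R) : binomial_tail n p 0 = 1.
Proof.
rewrite /binomial_tail big_mkord -[RHS](expr1n _ n) -[in RHS](subrK p 1).
rewrite exprDn; apply: eq_bigr => i _.
by rewrite !binomial_pmfE mulrC.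
Qed.

Lemma binomial_tail_recl (R : realType) (n : nat) (p : R) (k : nat) :
  (k <= n)%N ->
  binomial_tail n p k = binomial_pmf n p k + binomial_tail n p k.+1.
Proof. by move=> kn; rewrite /binomial_tail big_ltn. Qed.

Lemma binomial_tail_ge0 (R : realType) (n : nat) (p : R) (k : nat) :
  0 < p < 1 -> 0 <= binomial_tail n p k.
Proof.
move=> /andP[p0 p1]; apply: sumr_ge0 => i _.
by rewrite binomial_pmf_ge0// !ltW.
Qed.

Lemma binomial_tail_gt0 (R : realType) (n : nat) (p : R) (k : nat) :
  0 < p < 1 -> (k <= n)%N -> 0 < binomial_tail n p k.
Proof.
move=> p01 kn; rewrite binomial_tail_recl// ltr_pwDl//.
  exact: binomial_pmf_gt0.
exact: binomial_tail_ge0.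
Qed.

(** * Mean excess over k *)

(** This is the bound on E[X - k | X >= k] with both denominators cleared. *)
Lemma binomial_tail_excess (R : realType) (n : nat) (p : R) (k : nat) :
  0 < p < 1 -> n%:R * p <= k%:R -> (k <= n)%N ->
  (k%:R - n%:R * p + p)
    * \sum_(k <= i < n.+1) (i%:R - k%:R) * binomial_pmf n p i
  <= (n%:R - k%:R) * p * binomial_tail n p k.
Proof.
move=> /[dup] p01 /andP[p0 p1].
have [m] := ubnP (n - k); elim: m k => // m IH k nkm npk kn.
have [nk|kn'] := eqVneq k n.
  by rewrite nk big_nat1 !subrr !mul0r mulr0.
have {kn'}kn' : (k < n)%N by rewrite ltn_neqAle kn'.
set A := \sum_(k <= i < n.+1) _.
pose A' := \sum_(k.+1 <= i < n.+1) (i%:R - k.+1%:R) * binomial_pmf n p i.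
set S' := binomial_tail n p k.+1.
set b := binomial_pmf n p k.
have S'0 : 0 <= S' by exact: binomial_tail_ge0.
have A'0 : 0 <= A'.
  rewrite /A' big_nat_cond; apply: sumr_ge0 => i; rewrite andbT => /andP[ki _].
  by rewrite mulr_ge0 ?subr_ge0 ?ler_nat// binomial_pmf_ge0// !ltW.
have kSR : k.+1%:R = k%:R + 1 :> R by rewrite -addn1 natrD.
have AE : A = A' + S'.
  rewrite /A big_ltn// subrr mul0r add0r -big_split/=; apply: eq_bigr => i _.
  by rewrite kSR; ring.
(* The telescoped sum at k, with its first term moved to the other side. *)
have bE : b * ((n%:R - k%:R) * p) = A' + (1 + k%:R - n%:R * p) * S'.
  have := sum_centered_binomial_pmf p (leqW kn).
  rewrite big_ltn// -/b.
  rewrite (eq_bigr (fun i => (i%:R - k.+1%:R) * binomial_pmf n p i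
     + (k.+1%:R - n%:R * p) * binomial_pmf n p i)); last first.
    by move=> i _; ring.
  rewrite big_split/= -mulr_sumr -/A' -/(binomial_tail _ _ _) -/S' kSR; lra.
rewrite binomial_tail_recl// -/b -/S' AE.
have {}IH : (k%:R + 1 - n%:R * p + p) * A' <= (n%:R - (k%:R + 1)) * p * S'.
  by rewrite -kSR; apply: IH => //; [lia|rewrite kSR; lra].
have nk1 : k%:R + 1 <= n%:R :> R by rewrite -kSR ler_nat.
set D := k%:R - n%:R * p + p in IH *.
have D0 : 0 < D by rewrite /D; lra.
(* This is what remains of the claim after substituting [AE] and [bE]; for D > 1 the induction
   hypothesis bounds even A' (D + 1). *)
suff : A' * (D - 1) <= S' * ((n%:R - k%:R) * p + (1 - p)).
  move=> h; have := bE; rewrite /D in h *; lra.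
have [D1|D1] := leP D 1.
  rewrite (@le_trans _ _ 0)//; first by rewrite mulr_ge0_le0// subr_le0.
  by rewrite mulr_ge0// addr_ge0 ?mulr_ge0//; lra.
have {}IH : (D + 1) * A' <= (n%:R - (k%:R + 1)) * p * S'.
  by move: IH; rewrite /D; lra.
apply: (@le_trans _ _ (A' * (D + 1))); first by rewrite ler_wpM2l//; lra.
rewrite mulrC (le_trans IH)// mulrC ler_wpM2l//; nra.
Qed.

(** * Forcing the first trials to succeed *)

(** Of the two terms in Pascal's rule, only the one where the extra trial succeeds is kept. *)
Lemma binomial_tailS (R : realType) (n : nat) (p : R) (k : nat) :
  0 < p < 1 -> p * binomial_tail n p k <= binomial_tail n.+1 p k.+1.
Proof.
move=> /andP[p0 p1]; rewrite /binomial_tail big_add1/= mulr_sumr.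
apply: ler_sum => i _.
rewrite !binomial_pmfE subSS binS mulrnDr mulrnAr exprS mulrA lerDr.
by rewrite mulrn_wge0// !mulr_ge0 ?exprn_ge0 ?subr_ge0 ?(ltW p0) ?(ltW p1).
Qed.

Lemma binomial_tail_shift (R : realType) (n : nat) (p : R) (k m : nat) :
  0 < p < 1 -> (m <= k)%N -> (k <= n)%N ->
  p ^+ m * binomial_tail (n - m) p (k - m) <= binomial_tail n p k.
Proof.
move=> p01; elim: m k n => [|m IH] k n; first by rewrite expr0 mul1r !subn0.
case: k => // k; case: n => // n; rewrite !ltnS !subSS => mk kn.
rewrite (le_trans _ (binomial_tailS _ _ _))// exprS -mulrA ler_pM2l ?IH//.
by case/andP: p01.
Qed.

(** * Integers below the mean and the median *)

(** Reflecting the indices below j and padding with zeros puts the lower half on the same range as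
    the shifted upper half, so that the two subtract termwise. *)
Lemma sum_nat_rev_mkcond (R : nmodType) (F : nat -> R) (j M : nat) :
  (j <= M)%N ->
  \sum_(0 <= i < j) F i
  = \sum_(0 <= i < M) (if (i < j)%N then F (j - i.+1)%N else 0).
Proof.
move=> jM; rewrite (big_cat_nat (leq0n j) jM)/= [X in _ + X]big_nat_cond.
rewrite [X in _ + X]big1 ?addr0; last first.
  by move=> i; rewrite andbT => /andP[ji _]; rewrite ltnNge ji.
rewrite big_nat_rev/= add0n; apply: eq_big_nat => i /andP[_ ij].
by rewrite ij.
Qed.

Lemma sum_nat_shift_small (R : nmodType) (F : nat -> R) (j M : nat) :
  (forall i, (M <= i)%N -> F i = 0) -> (j <= M)%N ->
  \sum_(j <= i < M) F i = \sum_(0 <= i < M) F (j + i)%N.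
Proof.
move=> F0 jM; rewrite -{1}[j]add0n big_addn.
rewrite [RHS](big_cat_nat (leq0n (M - j)) (leq_subr _ _))/=.
rewrite [X in _ = _ + X]big_nat_cond [X in _ = _ + X]big1 ?addr0.
  by apply: eq_bigr => i _; rewrite addnC.
by move=> i; rewrite andbT => /andP[ji _]; apply: F0; rewrite -leq_subLR.
Qed.

Lemma binomial_tail_ge_half (R : realType) (n : nat) (p : R) (j : nat) :
  0 < p < 1 -> j%:R <= n%:R * p -> 2^-1 <= binomial_tail n p j.
Proof.
move=> /[dup] p01 /andP[p0 p1] jnp.
have b0 i : 0 <= binomial_pmf n p i by rewrite binomial_pmf_ge0// !ltW.
have q0 : 0 < 1 - p by rewrite subr_gt0.
have jn : (j <= n)%N.
  rewrite -(ler_nat R) (le_trans jnp)// ler_piMr//; exact: ltW.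
have [->|jpos] := posnP j; first by rewrite binomial_tail0; lra.
pose x i := binomial_pmf n p (j + i).
pose y i := if (i < j)%N then binomial_pmf n p (j - i.+1) else 0.
have upper (F : nat -> R) :
    \sum_(j <= i < n.+1) F i * binomial_pmf n p i
    = \sum_(0 <= i < n.+1) F (j + i)%N * x i.
  rewrite (@sum_nat_shift_small _ (fun i => F i * binomial_pmf n p i))//.
    by move=> i ni; rewrite binomial_pmf_small// mulr0.
  exact: leqW.
have lower (F : nat -> R) :
    \sum_(0 <= i < j) F i * binomial_pmf n p i
    = \sum_(0 <= i < n.+1) F (j - i.+1)%N * y i.
  rewrite (@sum_nat_rev_mkcond _ _ j n.+1) ?leqW//; apply: eq_bigr => i _.
  by rewrite /y; case: ifP => // _; rewrite mulr0.
have total : \sum_(0 <= i < n.+1) x i + \sum_(0 <= i < n.+1) y i = 1.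
  have := lower (fun=> 1); have := upper (fun=> 1).
  rewrite -!mulr_sumr !mul1r => <- <-.
  by rewrite addrC -big_cat_nat ?leqW// -[RHS](binomial_tail0 n p).
have tailE : binomial_tail n p j = \sum_(0 <= i < n.+1) x i.
  by have := upper (fun=> 1); rewrite -!mulr_sumr !mul1r.
(* The halves add up to 1, so the larger one is at least 1/2. *)
suff : 0 <= \sum_(0 <= i < n.+1) (x i - y i).
  by rewrite tailE sumrB; lra.
(* Both recurrences have the form required by [ratio_sign_change], with J = j and A = n + 1 - j. *)
have xS i : x i.+1 * (j%:R + i.+1%:R) * (1 - p)
            = (n.+1%:R - j%:R - i.+1%:R) * p * x i.
  have := binomial_pmf_step n p (j + i).
  rewrite -addnS -/(x i) -/(x i.+1) !natrD -[n.+1]addn1 -[i.+1]addn1 !natrD.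
  by move=> h; rewrite -mulrA h; ring.
have yS i : y i * (j%:R - i.+1%:R) * (1 - p)
            = (n.+1%:R - j%:R + i.+1%:R) * p * y i.+1.
  rewrite /y; case: (ltngtP i.+1 j) => [ij|ij|ij].
  - have := binomial_pmf_step n p (j - i.+2).
    rewrite -subSn// subSS !natrB// 1?ltnW// -[n.+1]addn1 -[i.+2]addn1 !natrD.
    by move=> h; rewrite -mulrA h; ring.
  - by rewrite !(mul0r, mulr0).
  - by rewrite ij subrr !(mul0r, mulr0).
(* This says j <= (n + 1) p, that is, b_(j-1) <= b_j. *)
have mode : (1 - p) * j%:R <= p * (n.+1%:R - j%:R).
  by rewrite -addn1 natrD; lra.
have jn1 : j%:R <= n.+1%:R :> R by rewrite ler_nat leqW.
have yx0 : y 0%N <= x 0%N.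
  rewrite /y /x jpos addn0 subn1; have := binomial_pmf_step n p j.-1.
  rewrite prednK// => h.
  have jR : 0 < j%:R :> R by rewrite ltr0n.
  rewrite -(ler_pM2r (mulr_gt0 jR q0)) h ler_wpM2l//.
  have -> : n%:R - j.-1%:R = n.+1%:R - j%:R :> R.
    by rewrite -{2}(prednK jpos) -!(addn1 n, addn1 j.-1) !natrD; ring.
  by rewrite mulrC [leRHS]mulrC.
apply: sum_ge0_sign_change.
- by rewrite subr_ge0.
- move=> i k; rewrite subr_lt0 subr_le0.
  apply: (@ratio_sign_change _ p (1 - p) (n.+1%:R - j%:R) j%:R) => //.
  + by rewrite subr_ge0.
  + by move=> ?; exact: b0.
  + by move=> ?; rewrite /y; case: ifP.
have := sum_centered_binomial_pmf p (leq0n n.+1).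
rewrite !mul0r (big_cat_nat (leq0n j) (leqW jn))/=.
rewrite (lower (fun i => i%:R - n%:R * p)) (upper (fun i => i%:R - n%:R * p)).
rewrite -big_split/= => mean.
set d : R := n%:R * p - j%:R.
have dge0 : 0 <= d by rewrite subr_ge0.
(* Subtracting the vanishing centered sum leaves only nonnegative terms: j + i - np = i - d and np -
   (j - 1 - i) = i + 1 + d. *)
rewrite -[leRHS]subr0 -[X in _ - X]mean -sumrB; apply: sumr_ge0 => i _.
have -> : i%:R * (x i - y i)
        - (((j - i.+1)%:R - n%:R * p) * y i + ((j + i)%:R - n%:R * p) * x i)
        = d * x i + (1 + d) * y i.
  rewrite /y; case: ifP => ij; last by rewrite natrD /d; ring.
  by rewrite natrB// natrD -[i.+1]addn1 natrD /d; ring.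
have yge0 : 0 <= y i by rewrite /y; case: ifP.
by rewrite addr_ge0// mulr_ge0//; [exact: b0|exact: addr_ge0].
Qed.

(** * Comparison of binomial coefficients *)

(** The quotient of the two sides is the product of (n - i) p / (k - i) over i < m; each induction
    step peels off one factor. *)
Lemma expr_binomial_le (R : realType) (n k m : nat) (p : R) :
  0 < p -> (m <= k)%N -> (k <= n)%N ->
  (forall i, (i < m)%N -> (n%:R - i%:R) * p <= k%:R - i%:R) ->
  p ^+ m * 'C(n, m)%:R <= 'C(k, m)%:R.
Proof.
move=> p0; elim: m => [|m IH] mk kn le; first by rewrite !bin0 expr0 mul1r.
have mR : 0 < m.+1%:R :> R by rewrite ltr0n.
rewrite -(ler_pM2l mR) -natrM mul_bin_left.
have -> : m.+1%:R * (p ^+ m.+1 * 'C(n, m.+1)%:R)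
        = p * p ^+ m * (m.+1 * 'C(n, m.+1))%:R :> R.
  by rewrite exprS natrM; ring.
rewrite mul_bin_left !natrM !natrB 1?ltnW//; last exact: leq_trans mk kn.
have -> : p * p ^+ m * ((n%:R - m%:R) * 'C(n, m)%:R)
        = ((n%:R - m%:R) * p) * (p ^+ m * 'C(n, m)%:R) :> R by ring.
apply: ler_pM.
- by rewrite mulr_ge0 ?(ltW p0)// subr_ge0 ler_nat (leq_trans (ltnW mk)).
- by rewrite mulr_ge0 ?exprn_ge0 ?(ltW p0).
- exact: le.
- by apply: IH => // [|i im]; [exact: ltnW|apply: le; exact: ltnW].
Qed.

(** * From the law of [X] to finite real sums *)

Lemma nneseries_EFin_small (R : realType) (f : nat -> R) (k n : nat) :
  (forall i, 0 <= f i) -> (forall i, (n <= i)%N -> f i = 0) -> (k <= n)%N ->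
  (\sum_(k <= i <oo) (f i)%:E)%E = (\sum_(k <= i < n) f i)%:E.
Proof.
move=> f0 fs kn; rewrite (@nneseries_split _ _ k (n - k)) => [|i _]; last first.
  by rewrite lee_fin.
rewrite subnKC// [X in (_ + X)%E]eseries0 ?adde0 ?sumEFin// => i ni _.
by rewrite fs.
Qed.

Lemma is_binomial_esum (d : measure_display) (T : measurableType d)
    (R : realType) (P : probability T R) (X : {RV P >-> nat}) (n : nat) (p : R)
    (A : set nat) :
  0 < p < 1 -> is_binomial X n p ->
  P (X @^-1` A) = \esum_(i in A) (binomial_pmf n p i)%:E.
Proof.
move=> /andP[p0 p1] X_bin; have := X_bin A; rewrite /binomial_prob.
by rewrite !ltW.
Qed.

Lemma is_binomial_eq (d : measure_display) (T : measurableType d)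
    (R : realType) (P : probability T R) (X : {RV P >-> nat}) (n : nat) (p : R)
    (i : nat) :
  0 < p < 1 -> is_binomial X n p ->
  P [set w | X w = i] = (binomial_pmf n p i)%:E.
Proof.
move=> p01 X_bin; have -> : [set w | X w = i] = X @^-1` [set i] by [].
rewrite (is_binomial_esum _ p01 X_bin) esum_set1// lee_fin.
by case/andP: p01 => p0 p1; rewrite binomial_pmf_ge0// !ltW.
Qed.

Lemma is_binomial_tail (d : measure_display) (T : measurableType d)
    (R : realType) (P : probability T R) (X : {RV P >-> nat}) (n : nat) (p : R)
    (k : nat) :
  0 < p < 1 -> is_binomial X n p -> (k <= n)%N ->
  P [set w | (k <= X w)%N] = (binomial_tail n p k)%:E.
Proof.
move=> p01 X_bin kn; have pmf_ge0 i : 0 <= binomial_pmf n p i.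
  by case/andP: p01 => p0 p1; rewrite binomial_pmf_ge0// !ltW.
have -> : [set w | (k <= X w)%N] = X @^-1` [set i | (k <= i)%N] by [].
rewrite (is_binomial_esum _ p01 X_bin) -nneseries_esum => [|i _]; last first.
  by rewrite lee_fin.
(* The condition k <= i on the indices becomes the lower end of the series. *)
have := @eseries_cond R (fun i => (binomial_pmf n p i)%:E) xpredT k.
rewrite /= => <-; rewrite (@nneseries_EFin_small _ _ _ n.+1)//.
  by move=> i ni; rewrite binomial_pmf_small.
exact: leqW.
Qed.

Lemma tail_cond_expectation_binomial (d : measure_display)
    (T : measurableType d) (R : realType) (P : probability T R)
    (X : {RV P >-> nat}) (n : nat) (p : R) (k : nat) :
  0 < p < 1 -> is_binomial X n p -> (k <= n)%N ->
  tail_cond_expectation X k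
  = ((\sum_(k <= i < n.+1) i%:R * binomial_pmf n p i) / binomial_tail n p k)%:E.
Proof.
move=> p01 X_bin kn; have pmf_ge0 i : 0 <= binomial_pmf n p i.
  by case/andP: p01 => p0 p1; rewrite binomial_pmf_ge0// !ltW.
rewrite /tail_cond_expectation (is_binomial_tail p01 X_bin)// inver.
(* Since k <= n the tail is positive, so the extended inverse is the real one. *)
rewrite gt_eqF ?binomial_tail_gt0// EFinM; congr (_ * _)%E.
rewrite -(@nneseries_EFin_small _ (fun i => i%:R * binomial_pmf n p i))//.
- apply/congr_lim/funext => m; apply: eq_bigr => i _.
  by rewrite (is_binomial_eq _ p01 X_bin).
- by move=> i; rewrite mulr_ge0.
- by move=> i ni; rewrite binomial_pmf_small// mulr0.
- exact: leqW.
Qed.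

(** * Both bounds for [X] *)

Theorem theorem1p1 (R : realType) (d : measure_display) (T : measurableType d)
    (P : probability T R) (X : {RV P >-> nat}) (n : nat) (p : R) (k : nat)
    (n_gt0 : (0 < n)%N) (p_gt0 : 0 < p) (p_lt1 : p < 1)
    (X_bin : is_binomial X n p)
    (k_gt0 : (0 < k)%N) (np_lt_k : n%:R * p < k%:R) (k_le_n : (k <= n)%N) :
  (tail_cond_expectation X k
     <= (k%:R + (n%:R - k%:R) * p / (k%:R - n%:R * p + p))%:E)%E
  /\
  ((k <= n - 1)%N ->
   let l : int := Num.floor ((k%:R - n%:R * p) / (1 - p)) in
   (l < k%:Z)
   /\
   ((p ^+ (2 * (`|l|%N + 1)) / 2%:R
       * ('C(n, `|l|%N + 1)%:R / 'C(k, `|l|%N + 1)%:R))%:E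
     <= P [set w | (k <= X w)%N])%E).
Proof.
have p01 : 0 < p < 1 by rewrite p_gt0.
have D0 : 0 < k%:R - n%:R * p + p by lra.
split.
  rewrite (tail_cond_expectation_binomial p01 X_bin)// lee_fin.
  have S0 := binomial_tail_gt0 p01 k_le_n.
  have excess := binomial_tail_excess p01 (ltW np_lt_k) k_le_n.
  (* Writing i = (i - k) + k splits off k and leaves the mean excess. *)
  rewrite ler_pdivrMr// (eq_bigr (fun i => (i%:R - k%:R) * binomial_pmf n p i
     + k%:R * binomial_pmf n p i)) => [|i _]; last by ring.
  rewrite big_split/= -mulr_sumr -/(binomial_tail n p k) mulrDl addrC lerD2l.
  by rewrite mulrAC ler_pdivlMr// mulrC.
move=> k_le_n1 l.
have k_lt_n : (k < n)%N by lia.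
have q0 : 0 < 1 - p by rewrite subr_gt0.
have l_ge0 : 0 <= l by rewrite floor_ge0 divr_ge0 ?subr_ge0// ltW.
(* Hence k - np < k (1 - p), which gives l < k. *)
have kpnp : k%:R * p < n%:R * p by rewrite ltr_pM2r// ltr_nat.
have l_lt_k : l < k%:Z.
  by rewrite floor_lt_int ltr_pdivrMr// -pmulrn; lra.
split=> //.
have [ll lu] : `|l|%:R * (1 - p) <= k%:R - n%:R * p
             /\ k%:R - n%:R * p < `|l|.+1%:R * (1 - p).
  have /andP[] := floor_itv ((k%:R - n%:R * p) / (1 - p)); rewrite -/l.
  rewrite -(gez0_abs l_ge0) intrD -!pmulrn ler_pdivlMr// ltr_pdivrMr//.
  by rewrite -[`|l|.+1]addn1 natrD.
have lk : (`|l| < k)%N by rewrite -ltz_nat gez0_abs.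
rewrite (is_binomial_tail p01 X_bin)// lee_fin addn1.
set m := `|l|.+1 in lu *.
have mk : (m <= k)%N by [].
(* For i <= l, i (1 - p) <= k - np rearranges to (n - i) p <= k - i. *)
have bin_le : p ^+ m * 'C(n, m)%:R <= 'C(k, m)%:R.
  apply: expr_binomial_le => // i im.
  have il : i%:R <= `|l|%:R :> R by rewrite ler_nat.
  have := ler_wpM2r (ltW q0) il; lra.
(* The upper floor bound k - np < m (1 - p) says k - m < (n - m) p. *)
have half : 2^-1 <= binomial_tail (n - m) p (k - m).
  apply: binomial_tail_ge_half => //.
  rewrite !natrB// ?(leq_trans mk)//; lra.
apply: le_trans (binomial_tail_shift p01 mk k_le_n).
rewrite (@le_trans _ _ (p ^+ m * 2^-1))//; last first.
  by rewrite ler_wpM2l// exprn_ge0// ltW.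
have Ck : 0 < 'C(k, m)%:R :> R by rewrite ltr0n bin_gt0.
(* One factor p^m joins the binomial quotient, which is then at most 1 by [bin_le]. *)
have -> : p ^+ (2 * m) / 2%:R * ('C(n, m)%:R / 'C(k, m)%:R)
        = (p ^+ m * 2^-1) * ((p ^+ m * 'C(n, m)%:R) / 'C(k, m)%:R).
  by rewrite mul2n -addnn exprD; ring.
rewrite ler_piMr ?ler_pdivrMr ?mul1r//.
by rewrite mulr_ge0 ?invr_ge0// exprn_ge0// ltW.
Qed.
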